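(* Let $n,m$ be positive integers and let $G^J=Sp(n,\mathbb{R})\ltimes H_{\mathbb{R}}^{(n,m)}$ be the Jacobi group, with multiplication $$(M,(\lambda,\mu;\kappa))\cdot(M',(\lambda',\mu';\kappa'))=(MM',(\tilde\lambda+\lambda',\tilde\mu+\mu';\kappa+\kappa'+\tilde\lambda\,{}^t\mu'-\tilde\mu\,{}^t\lambda')),\quad (\tilde\lambda,\tilde\mu)=(\lambda,\mu)M',$$ where $H_{\mathbb{R}}^{(n,m)}=\{(\lambda,\mu;\kappa):\lambda,\mu\in\mathbb{R}^{(m,n)},\kappa\in\mathbb{R}^{(m,m)},\kappa+\mu\,{}^t\lambda\text{ symmetric}\}$. Let $$K^J=\left\{\left(\begin{pmatrix} A & -B\\ B & A\end{pmatrix},(0,0;\kappa)\right): A\,{}^tA+B\,{}^tB=I_n,\ A\,{}^tB=B\,{}^tA,\ A,B\in\mathbb{R}^{(n,n)},\ \kappa={}^t\kappa\in\mathbb{R}^{(m,m)}\right\},$$ and let $\mathfrak{p}^J=\left\{\left(\begin{pmatrix} X & Y\\ Y & -X\end{pmatrix},(P,Q,0)\right): X={}^tX,\ Y={}^tY\in\mathbb{R}^{(n,n)},\ P,Q\in\mathbb{R}^{(m,n)}\right\}$, viewed as a subspace of the Lie algebra of $G^J$ (pairs $(Z,(P,Q,R))$ with $Z\in\mathfrak{sp}(n,\mathbb{R})$, $P,Q\in\mathbb{R}^{(m,n)}$, $R={}^tR\in\mathbb{R}^{(m,m)}$), on which $K^J$ acts by the adjoint action $\mathrm{Ad}$. Let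 $T_n$ be the space of complex symmetric $n\times n$ matrices and $T_{n,m}=T_n\times\mathbb{C}^{(m,n)}$, regarded as a real vector space. Define $\Phi:\mathfrak{p}^J\to T_{n,m}$ by $$\Phi\left(\begin{pmatrix} X & Y\\ Y & -X\end{pmatrix},(P,Q,0)\right)=(X+iY,\ P+iQ),$$ and $\theta:K^J\to U(n)\times S(m,\mathbb{R})$ by $\theta\left(\begin{pmatrix} A & -B\\ B & A\end{pmatrix},(0,0;\kappa)\right)=(A+iB,\kappa)$, where $S(m,\mathbb{R})$ is the additive group of real symmetric $m\times m$ matrices. Let $U(n)\times S(m,\mathbb{R})$ act on $T_{n,m}$ by $$(h,\kappa)\cdot(\omega,z)=(h\,\omega\,{}^th,\ z\,{}^th).$$ Then for all $k^J\in K^J$ and $\alpha\in\mathfrak{p}^J$, $$\Phi(\mathrm{Ad}(k^J)\alpha)=\theta(k^J)\cdot\Phi(\alpha).$$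
   Context: $\mathbb{R}^{(k,l)}$ (resp. $\mathbb{C}^{(k,l)}$) denotes real (resp. complex) $k\times l$ matrices, ${}^tM$ the transpose, $U(n)$ the unitary group. $Sp(n,\mathbb{R})=\{M\in\mathbb{R}^{(2n,2n)}: {}^tMJ_nM=J_n\}$ with $J_n=\begin{pmatrix}0&I_n\\-I_n&0\end{pmatrix}$. $K^J$ is the stabilizer in $G^J$ of the point $(iI_n,0)$ of the Siegel-Jacobi space. *)

(* Defs.v *)
From HB Require Import structures.
From mathcomp Require Import all_boot all_order all_algebra.
From mathcomp Require Import complex spectral.
From mathcomp Require Import all_classical all_reals all_analysis.
From mathcomp Require Import ring.

Set Implicit Arguments.
Unset Strict Implicit.
Unset Printing Implicit Defensive.

Import Order.TTheory GRing.Theory Num.Theory numFieldNormedType.Exports.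

Local Open Scope classical_set_scope.
Local Open Scope ring_scope.

(* Coordinates (M, (lambda, mu, kappa)).  This is the normed space in which    *)
(* both G^J (as a closed submanifold) and its Lie algebra (as the tangent      *)
(* space at the identity) live.                                                *)
Notation coordJ R n m :=
  ('M[R]_(n + n) * ('M[R]_(m, n) * 'M[R]_(m, n) * 'M[R]_m))%type.

Section JacobiGroup.
Variables (R : realType) (n m : nat).

Definition Jmx : 'M[R]_(n + n) := block_mx 0 1%:M (- 1%:M) 0.

Definition symplectic (M : 'M[R]_(n + n)) : bool := M^T *m Jmx *m M == Jmx.

Definition inGJ (g : coordJ R n m) : bool :=
  let: (M, (l, u, k)) := g in
  symplectic M && ((k + u *m l^T)^T == k + u *m l^T).

(* The formula makes sense on all of coordJ, but is a group law on G^J only.   *)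
Definition mulJ (g g' : coordJ R n m) : coordJ R n m :=
  let: (M, (l, u, k)) := g in
  let: (M', (l', u', k')) := g' in
  let lt := lsubmx (row_mx l u *m M') in
  let ut := rsubmx (row_mx l u *m M') in
  (M *m M', (lt + l', ut + u', k + k' + lt *m u'^T - ut *m l'^T)).

Definition oneJ : coordJ R n m := (1%:M, (0, 0, 0)).

Definition invJ (g : coordJ R n m) : coordJ R n m :=
  let: (M, (l, u, k)) := g in
  (invmx M, (- lsubmx (row_mx l u *m invmx M), - rsubmx (row_mx l u *m invmx M),
             - k + l *m u^T - u *m l^T)).

Lemma Jmx_sqr : Jmx *m Jmx = - 1%:M.
Proof.
rewrite /Jmx mulmx_block !mul0mx !mulmx0 !mul1mx !mulmx1 !addr0 !add0r.
by rewrite [X in _ = - X](scalar_mx_block n n) opp_block_mx oppr0.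
Qed.

Lemma Jmx_unit : Jmx \in unitmx.
Proof.
have h : Jmx *m (- Jmx) = 1%:M by rewrite mulmxN Jmx_sqr opprK.
by have [] := mulmx1_unit h.
Qed.

Lemma symplectic_unit M : symplectic M -> M \in unitmx.
Proof. by move=> /eqP h; have := Jmx_unit; rewrite -h unitmx_mul => /andP[]. Qed.

Lemma symplectic1 : symplectic 1%:M.
Proof. by rewrite /symplectic trmx1 mul1mx mulmx1. Qed.

Lemma symplecticM M N : symplectic M -> symplectic N -> symplectic (M *m N).
Proof.
move=> /eqP hM /eqP hN; apply/eqP.
by rewrite trmx_mul !mulmxA -2!(mulmxA (N^T)) hM hN.
Qed.

Lemma symplecticV M : symplectic M -> symplectic (invmx M).
Proof.
move=> hM; have uM := symplectic_unit hM; move/eqP: hM => hM; apply/eqP.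
rewrite -{1}hM !mulmxA -trmx_mul mulmxV // trmx1 mul1mx.
by rewrite -mulmxA mulmxV // mulmx1.
Qed.

Lemma symplectic_tr M : symplectic M -> M *m Jmx *m M^T = Jmx.
Proof.
move=> /eqP hM.
have e : (M *m Jmx) *m (M^T *m - Jmx) = 1%:M.
  apply: mulmx1C.
  by rewrite mulmxN mulNmx mulmxA hM Jmx_sqr opprK.
have := congr1 (mulmxr Jmx) e; rewrite /= mul1mx mulmxN mulmxN mulNmx.
by rewrite !mulmxA -[_ *m Jmx *m Jmx]mulmxA Jmx_sqr mulmxN mulmx1 opprK.
Qed.

Definition om p (v w : 'M[R]_(p, n + n)) : 'M[R]_p := v *m Jmx *m w^T.

Lemma omE p (l u l' u' : 'M[R]_(p, n)) :
  om (row_mx l u) (row_mx l' u') = l *m u'^T - u *m l'^T.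
Proof.
rewrite /om /Jmx mul_row_block !mulmx0 mulmx1 mulmxN mulmx1 add0r addr0.
by rewrite tr_row_mx mul_row_col mulNmx addrC.
Qed.

Lemma omM p (v w : 'M[R]_(p, n + n)) M :
  symplectic M -> om (v *m M) (w *m M) = om v w.
Proof.
move=> /symplectic_tr h.
by rewrite /om trmx_mul !mulmxA -2!(mulmxA v) h.
Qed.

Lemma omDl p (v v' w : 'M[R]_(p, n + n)) : om (v + v') w = om v w + om v' w.
Proof. by rewrite /om !mulmxDl. Qed.

Lemma omDr p (v v' w : 'M[R]_(p, n + n)) : om w (v + v') = om w v + om w v'.
Proof. by rewrite /om raddfD /= mulmxDr. Qed.

Lemma omNr p (v w : 'M[R]_(p, n + n)) : om v (- w) = - om v w.
Proof. by rewrite /om raddfN /= mulmxN. Qed.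

Lemma omNl p (v w : 'M[R]_(p, n + n)) : om (- v) w = - om v w.
Proof. by rewrite /om !mulNmx. Qed.

Lemma om_tr p (v w : 'M[R]_(p, n + n)) : (om v w)^T = - om w v.
Proof.
have JT : Jmx^T = - Jmx.
  by rewrite /Jmx tr_block_mx !trmx0 raddfN /= trmx1 opp_block_mx oppr0 opprK.
by rewrite /om !trmx_mul trmxK JT mulNmx mulmxN mulmxA.
Qed.

Lemma inGJE M l u k : inGJ (M, (l, u, k)) =
  symplectic M && (k - k^T == om (row_mx l u) (row_mx l u)).
Proof.
congr andb; rewrite omE raddfD /= trmx_mul trmxK eq_sym.
by rewrite -subr_eq0 -[RHS]subr_eq0; congr (_ == _); rewrite opprD opprB addrACA.
Qed.

Lemma mulJE M l u k M' l' u' k' :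
  mulJ (M, (l, u, k)) (M', (l', u', k')) =
  (M *m M', (lsubmx (row_mx l u *m M') + l', rsubmx (row_mx l u *m M') + u',
    k + k' + om (row_mx l u *m M') (row_mx l' u'))).
Proof. by rewrite -[X in om X _]hsubmxK omE addrA. Qed.

Lemma row_mulJ M (l u l' u' : 'M[R]_(m, n)) :
  row_mx (lsubmx (row_mx l u *m M) + l') (rsubmx (row_mx l u *m M) + u') =
  row_mx l u *m M + row_mx l' u'.
Proof. by rewrite -add_row_mx hsubmxK. Qed.

Lemma mulJ_inGJ g g' : inGJ g -> inGJ g' -> inGJ (mulJ g g').
Proof.
case: g => M [[l u] k]; case: g' => M' [[l' u'] k'].
rewrite mulJE !inGJE row_mulJ => /andP[hM /eqP hk] /andP[hM' /eqP hk'].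
rewrite symplecticM //=; apply/eqP.
rewrite omDl !omDr omM // -hk -hk' !raddfD /= om_tr opprK.
set a := om _ _; set b := om _ _.
apply/matrixP => i j; rewrite !mxE; ring.
Qed.

Lemma oneJ_inGJ : inGJ oneJ.
Proof.
by rewrite inGJE symplectic1 row_mx0 /om !mul0mx trmx0 subrr eqxx.
Qed.

Lemma invJE M l u k : invJ (M, (l, u, k)) =
  (invmx M, (- lsubmx (row_mx l u *m invmx M), - rsubmx (row_mx l u *m invmx M),
   - k + om (row_mx l u) (row_mx l u))).
Proof. by rewrite omE addrA. Qed.

Lemma row_invJ M (l u : 'M[R]_(m, n)) :
  row_mx (- lsubmx (row_mx l u *m invmx M)) (- rsubmx (row_mx l u *m invmx M))
  = - (row_mx l u *m invmx M).
Proof. by rewrite -opp_row_mx hsubmxK. Qed.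

Lemma invJ_inGJ g : inGJ g -> inGJ (invJ g).
Proof.
case: g => M [[l u] k]; rewrite invJE !inGJE row_invJ => /andP[hM /eqP hk].
rewrite symplecticV //=; apply/eqP.
rewrite omNr omNl opprK omM ?symplecticV // -hk.
apply/matrixP => i j; rewrite !mxE; ring.
Qed.

Record GJ : Type := MkGJ { GJval :> coordJ R n m; _ : inGJ GJval }.
HB.instance Definition _ := [isSub for GJval].
HB.instance Definition _ := [Choice of GJ by <:].

Let GJ_one : GJ := MkGJ oneJ_inGJ.
Let GJ_mul (g h : GJ) : GJ := MkGJ (mulJ_inGJ (valP g) (valP h)).
Let GJ_inv (g : GJ) : GJ := MkGJ (invJ_inGJ (valP g)).

Lemma GJ_mulA : associative GJ_mul.
Proof.
case=> [[M1 [[l1 u1] k1]] h1] [[M2 [[l2 u2] k2]] h2] [[M3 [[l3 u3] k3]] h3].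
apply/val_inj => /=; have s3 : symplectic M3 by case/andP: h3.
change (mulJ (M1, (l1, u1, k1)) (mulJ (M2, (l2, u2, k2)) (M3, (l3, u3, k3))) =
  mulJ (mulJ (M1, (l1, u1, k1)) (M2, (l2, u2, k2))) (M3, (l3, u3, k3))).
rewrite !mulJE !row_mulJ !mulmxDl !mulmxA !omDl !omDr omM //.
by rewrite !raddfD /=; congr (_, (_, _, _)); apply/matrixP => i j; rewrite !mxE; ring.
Qed.

Lemma GJ_mul1 : left_id GJ_one GJ_mul.
Proof.
case=> [[M [[l u] k]] h]; apply/val_inj => /=.
change (mulJ oneJ (M, (l, u, k)) = (M, (l, u, k))).
rewrite mulJE row_mx0 !mul0mx !mul1mx !raddf0 /om !mul0mx.
by rewrite !add0r addr0.
Qed.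

Lemma GJ_mulr1 : right_id GJ_one GJ_mul.
Proof.
case=> [[M [[l u] k]] h]; apply/val_inj => /=.
change (mulJ (M, (l, u, k)) oneJ = (M, (l, u, k))).
rewrite mulJE row_mx0 !mulmx1 row_mxKl row_mxKr /om trmx0 mulmx0.
by rewrite !addr0.
Qed.

Lemma GJ_mulV : left_inverse GJ_one GJ_inv GJ_mul.
Proof.
case=> [[M [[l u] k]] h]; apply/val_inj => /=.
change (mulJ (invJ (M, (l, u, k))) (M, (l, u, k)) = oneJ).
have uM : M \in unitmx by case/andP: h => /symplectic_unit.
rewrite invJE mulJE row_invJ mulNmx mulmxKV // mulVmx // omNl.
rewrite !raddfN /= row_mxKl row_mxKr.
by congr (_, (_, _, _)); apply/matrixP => i j; rewrite !mxE; ring.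
Qed.

Lemma GJ_mulrV : right_inverse GJ_one GJ_inv GJ_mul.
Proof.
case=> [[M [[l u] k]] h]; apply/val_inj => /=.
change (mulJ (M, (l, u, k)) (invJ (M, (l, u, k))) = oneJ).
have [sM uM] : symplectic M /\ M \in unitmx.
  by case/andP: h => sM _; split=> //; exact: symplectic_unit.
rewrite invJE mulJE row_invJ omNr omM ?symplecticV // mulmxV // !subrr.
by rewrite addrA subrr add0r subrr.
Qed.

HB.instance Definition _ :=
  isGroup.Build GJ GJ_mulA GJ_mul1 GJ_mulr1 GJ_mulV GJ_mulrV.

Lemma GJval_mul (g h : GJ) : (g * h)%g = mulJ g h :> coordJ R n m.
Proof. by []. Qed.

Lemma GJval_inv (g : GJ) : (g^-1)%g = invJ g :> coordJ R n m.
Proof. by []. Qed.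

Lemma GJval_one : (1 : GJ)%g = oneJ :> coordJ R n m.
Proof. by []. Qed.

End JacobiGroup.

Section Differentiability.
Variables (R : realType) (V : normedModType R).

Lemma differentiable_mx p q (f : V -> 'M[R]_(p, q)) x :
  (forall i j, differentiable (fun y => f y i j : R) x) -> differentiable f x.
Proof.
move=> df.
have -> : f = \sum_i \sum_j (fun y => f y i j *: delta_mx i j).
  apply/funext => y; rewrite fct_sumE [LHS]matrix_sum_delta.
  by apply: eq_bigr => i _; rewrite fct_sumE.
by do 2!apply: differentiable_sum => ?; exact: differentiableZl.
Qed.

Lemma differentiable_entry p q (f : V -> 'M[R]_(p, q)) x i j :
  differentiable f x -> differentiable (fun y => f y i j : R) x.
Proof.
move=> df; apply: (@differentiable_comp _ _ _ _ f (fun M => M i j)) => //.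
exact: differentiable_coord.
Qed.

Lemma differentiable_mulmx p q r (f : V -> 'M[R]_(p, q))
    (g : V -> 'M[R]_(q, r)) x :
  differentiable f x -> differentiable g x ->
  differentiable (fun y => f y *m g y) x.
Proof.
move=> df dg; apply: differentiable_mx => i j.
have -> : (fun y => (f y *m g y) i j : R) =
          \sum_k ((fun y => f y i k) * (fun y => g y k j)).
  by apply/funext => y; rewrite fct_sumE mxE.
by apply: differentiable_sum => k; apply: differentiableM;
   exact: differentiable_entry.
Qed.

Lemma differentiable_trmx p q (f : V -> 'M[R]_(p, q)) x :
  differentiable f x -> differentiable (fun y => (f y)^T) x.
Proof.
move=> df; apply: differentiable_mx => i j.
have -> : (fun y => (f y)^T i j : R) = fun y => f y j i.
  by apply/funext => y; rewrite mxE.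
exact: differentiable_entry.
Qed.

Lemma differentiable_row_mx p q1 q2 (f : V -> 'M[R]_(p, q1))
    (g : V -> 'M[R]_(p, q2)) x :
  differentiable f x -> differentiable g x ->
  differentiable (fun y => row_mx (f y) (g y)) x.
Proof.
move=> df dg; apply: differentiable_mx => i j; case: (split_ordP j) => k ->.
- under eq_fun do rewrite row_mxEl; exact: differentiable_entry.
- under eq_fun do rewrite row_mxEr; exact: differentiable_entry.
Qed.

Lemma differentiable_fst (W1 W2 : normedModType R) (f : V -> W1 * W2) x :
  differentiable f x -> differentiable (fun y => (f y).1) x.
Proof.
move=> df; apply: (@differentiable_comp _ _ _ _ f fst) => //.
by apply: linear_differentiable => ?; exact: cvg_fst.
Qed.

Lemma differentiable_snd (W1 W2 : normedModType R) (f : V -> W1 * W2) x :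
  differentiable f x -> differentiable (fun y => (f y).2) x.
Proof.
move=> df; apply: (@differentiable_comp _ _ _ _ f snd) => //.
by apply: linear_differentiable => ?; exact: cvg_snd.
Qed.

Lemma differentiable_mulJ n m (f g : V -> coordJ R n m) x :
  differentiable f x -> differentiable g x ->
  differentiable (fun y => mulJ (f y) (g y)) x.
Proof.
move=> df dg.
pose rw y := row_mx (f y).2.1.1 (f y).2.1.2 *m (g y).1.
have -> : (fun y => mulJ (f y) (g y)) = fun y =>
    ((f y).1 *m (g y).1,
     (lsubmx (rw y) + (g y).2.1.1, rsubmx (rw y) + (g y).2.1.2,
      (f y).2.2 + (g y).2.2 + lsubmx (rw y) *m (g y).2.1.2^T
        - rsubmx (rw y) *m (g y).2.1.1^T)).
  apply/funext => y; rewrite /rw.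
  by case: (f y) => [? [[? ?] ?]]; case: (g y) => [? [[? ?] ?]].
have drw : differentiable rw x.
  apply: differentiable_mulmx; last exact: differentiable_fst.
  apply: differentiable_row_mx.
    by do 2!apply: differentiable_fst; exact: differentiable_snd.
  by apply: differentiable_snd; apply: differentiable_fst;
     exact: differentiable_snd.
have dl : differentiable (fun y => lsubmx (rw y)) x.
  exact: (differentiable_comp drw (differentiable_lsubmx _)).
have dr : differentiable (fun y => rsubmx (rw y)) x.
  exact: (differentiable_comp drw (differentiable_rsubmx _)).
have d2 h : differentiable h x -> differentiable (fun y => (h y : coordJ R n m).2.2) x.
  by move=> ?; do 2!apply: differentiable_snd.
have dgl : differentiable (fun y => (g y).2.1.1) x.
  by do 2!apply: differentiable_fst; exact: differentiable_snd.
have dgu : differentiable (fun y => (g y).2.1.2) x.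
  by apply: differentiable_snd; apply: differentiable_fst;
     exact: differentiable_snd.
apply: differentiable_pair.
  by apply: differentiable_mulmx; exact: differentiable_fst.
apply: differentiable_pair.
  by apply: differentiable_pair; apply: differentiableD.
apply: differentiableB; last first.
  by apply: differentiable_mulmx => //; exact: differentiable_trmx.
apply: differentiableD; last first.
  by apply: differentiable_mulmx => //; exact: differentiable_trmx.
by apply: differentiableD; exact: d2.
Qed.

End Differentiability.

Section Adjoint.
Variables (R : realType) (n m : nat).

Definition conjJ (g : GJ R n m) (x : coordJ R n m) : coordJ R n m :=
  mulJ (mulJ g x) (g^-1)%g.

Lemma conjJ_val (g h : GJ R n m) : conjJ g h = (g * h * g^-1)%g.
Proof. by []. Qed.

(* Ad g is the differential at the identity of x |-> g x g^-1; see Ad_curve.   *)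
Definition Ad (g : GJ R n m) (a : coordJ R n m) : coordJ R n m :=
  'd (conjJ g) (GJval (1 : GJ R n m)%g) a.

Lemma differentiable_conjJ (g : GJ R n m) x : differentiable (conjJ g) x.
Proof.
apply: differentiable_mulJ; last exact: differentiable_cst.
by apply: differentiable_mulJ; first exact: differentiable_cst.
Qed.

Lemma Ad_curve (g : GJ R n m) (c : R -> GJ R n m) (a : coordJ R n m) :
  c 0 = 1%g -> is_derive (0 : R) 1 (fun t => GJval (c t)) a ->
  is_derive (0 : R) 1 (fun t => GJval (g * c t * g^-1)%g) (Ad g a).
Proof.
move=> c0 [dc ca].
have Dc : differentiable (fun t => GJval (c t)) (0 : R).
  exact/derivable1_diffP.
have Dg := differentiable_conjJ g (GJval (c 0)).
have D := differentiable_comp Dc Dg.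
apply: DeriveDef; first exact/derivable1_diffP.
rewrite (deriveE _ D).
rewrite (diff_comp Dc Dg) /= -(deriveE _ Dc) ca.
by rewrite /Ad c0.
Qed.

End Adjoint.

Section CartanData.
Variables (R : realType) (n m : nat).

Definition gJ : set (coordJ R n m) :=
  [set a | let: (Z, (_, _, T)) := a in
           Z^T *m Jmx R n + Jmx R n *m Z = 0 /\ T^T = T].

Definition pJ : set (coordJ R n m) :=
  [set a | exists (X Y : 'M[R]_n) (P Q : 'M[R]_(m, n)),
    [/\ X^T = X, Y^T = Y & a = (block_mx X Y Y (- X), (P, Q, 0))]].

Definition KJ : set (GJ R n m) :=
  [set g | exists (A B : 'M[R]_n) (k : 'M[R]_m),
    [/\ A *m A^T + B *m B^T = 1%:M, A *m B^T = B *m A^T, k^T = k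
      & GJval g = (block_mx A (- B) B A, (0, 0, k))]].

(* A + iB *)
Definition cplxmx p q (A B : 'M[R]_(p, q)) : 'M[R[i]]_(p, q) :=
  \matrix_(i, j) Complex (A i j) (B i j).

Lemma cplxmx_mul p q r (A B : 'M[R]_(p, q)) (C D : 'M[R]_(q, r)) :
  cplxmx A B *m cplxmx C D = cplxmx (A *m C - B *m D) (A *m D + B *m C).
Proof.
apply/matrixP => i j; rewrite !mxE -sumrB -big_split /=.
under eq_bigr do rewrite !mxE.
by elim/big_rec3: _ => [|k x y z _ ->]; [|apply/eqP; rewrite eq_complex /= !eqxx].
Qed.

Lemma cplxmx_tr p q (A B : 'M[R]_(p, q)) : (cplxmx A B)^T = cplxmx A^T B^T.
Proof. by apply/matrixP => i j; rewrite !mxE. Qed.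

Definition Tnm : set ('M[R[i]]_n * 'M[R[i]]_(m, n)) :=
  [set w | w.1^T = w.1].

Definition USnm : set ('M[R[i]]_n * 'M[R]_m) :=
  [set hk | hk.1 \is unitarymx /\ hk.2^T = hk.2].

Definition actUS (hk : 'M[R[i]]_n * 'M[R]_m)
    (w : 'M[R[i]]_n * 'M[R[i]]_(m, n)) : 'M[R[i]]_n * 'M[R[i]]_(m, n) :=
  (hk.1 *m w.1 *m hk.1^T, w.2 *m hk.1^T).

(* Phi and theta read X, Y and A, B off the blocks of the matrix part; they    *)
(* are meaningful on pJ and KJ, see PhiE and thetaE.                           *)
Definition Phi (a : coordJ R n m) : 'M[R[i]]_n * 'M[R[i]]_(m, n) :=
  let: (Z, (P, Q, _)) := a in (cplxmx (ulsubmx Z) (ursubmx Z), cplxmx P Q).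

Definition theta (g : GJ R n m) : 'M[R[i]]_n * 'M[R]_m :=
  let: (M, (_, _, k)) := GJval g in (cplxmx (ulsubmx M) (dlsubmx M), k).

Lemma PhiE X Y P Q :
  Phi (block_mx X Y Y (- X), (P, Q, 0)) = (cplxmx X Y, cplxmx P Q).
Proof. by rewrite /Phi block_mxKul block_mxKur. Qed.

Lemma thetaE (g : GJ R n m) A B k :
  GJval g = (block_mx A (- B) B A, (0, 0, k)) -> theta g = (cplxmx A B, k).
Proof. by rewrite /theta => ->; rewrite block_mxKul block_mxKdl. Qed.

Lemma pJ_gJ : pJ `<=` gJ.
Proof.
move=> _ [X [Y [P [Q [hX hY ->]]]]]; split; last by rewrite trmx0.
rewrite /Jmx tr_block_mx !mulmx_block [(- X)^T]raddfN /= hX hY.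
rewrite !(mul0mx, mulmx0, mul1mx, mulmx1, mulmxN, mulNmx, addr0, add0r).
by rewrite opprK add_block_mx [- Y + Y]addrC !subrr block_mx0.
Qed.

Lemma KJ_mx_inv (A B : 'M[R]_n) :
  A *m A^T + B *m B^T = 1%:M -> A *m B^T = B *m A^T ->
  block_mx A (- B) B A *m (block_mx A (- B) B A)^T = 1%:M.
Proof.
move=> h1 h2; rewrite tr_block_mx mulmx_block [(- B)^T]raddfN /=.
rewrite !(mulmxN, mulNmx) opprK h1 h2 subrr [_ + A *m A^T]addrC h1.
by rewrite -scalar_mx_block.
Qed.

(* Every matrix in the displayed form of K^J does belong to G^J.               *)
Lemma KJ_inGJ (A B : 'M[R]_n) (k : 'M[R]_m) :
  A *m A^T + B *m B^T = 1%:M -> A *m B^T = B *m A^T -> k^T = k ->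
  inGJ ((block_mx A (- B) B A, (0, 0, k)) : coordJ R n m).
Proof.
move=> h1 h2 hk; rewrite /inGJ mul0mx addr0 hk eqxx andbT.
apply/eqP; have e := mulmx1C (KJ_mx_inv h1 h2).
set M := block_mx _ _ _ _ in e *.
suff JM : Jmx R n *m M = M *m Jmx R n by rewrite -mulmxA JM mulmxA e mul1mx.
rewrite /Jmx /M !mulmx_block.
by rewrite !(mul0mx, mulmx0, mul1mx, mulmx1, mulmxN, mulNmx, addr0, add0r) opprK.
Qed.

Lemma Phi_Tnm : set_fun pJ Tnm Phi.
Proof.
move=> _ [X [Y [P [Q [hX hY ->]]]]]; rewrite PhiE /Tnm /=.
by apply/matrixP => i j; rewrite !mxE -{1}hX -{1}hY !mxE.
Qed.

Lemma theta_USnm : set_fun KJ USnm theta.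
Proof.
move=> g [A [B [k [h1 h2 hk hg]]]]; rewrite (thetaE hg); split=> //=.
apply/unitarymxP.
rewrite [X in _ *m X](_ : _ = cplxmx A^T (- B^T)); last first.
  by apply/matrixP => i j; rewrite !mxE.
rewrite cplxmx_mul !mulmxN opprK h1 h2 addrC subrr.
by apply/matrixP => i j; rewrite !mxE; case: eqP.
Qed.

Lemma actUS_Tnm hk : set_fun Tnm Tnm (actUS hk).
Proof. by move=> w hw; rewrite /Tnm /= !trmx_mul trmxK hw mulmxA. Qed.

Lemma KJ_conjJ (g : GJ R n m) (A B : 'M[R]_n) (k : 'M[R]_m) M l u c :
  A *m A^T + B *m B^T = 1%:M -> A *m B^T = B *m A^T ->
  GJval g = (block_mx A (- B) B A, (0, 0, k)) ->
  let N := block_mx A (- B) B A in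
  conjJ g (M, (l, u, c)) =
  (N *m M *m N^T, (lsubmx (row_mx l u *m N^T), rsubmx (row_mx l u *m N^T), c)).
Proof.
move=> h1 h2 hg N; have e : N *m N^T = 1%:M by exact: KJ_mx_inv.
have uN : N \in unitmx by case: (mulmx1_unit e).
have eN : invmx N = N^T by rewrite -[RHS]mul1mx -(mulVmx uN) -mulmxA e mulmx1.
rewrite /conjJ GJval_inv hg -/N /invJ eN /mulJ.
rewrite !(row_mx0, mul0mx, mulmx0, trmx0, raddf0, addr0, add0r, subr0, oppr0).
by rewrite /= addrAC subrr add0r.
Qed.

Lemma Ad_KJ (g : GJ R n m) (A B : 'M[R]_n) (k : 'M[R]_m) Z P Q T :
  A *m A^T + B *m B^T = 1%:M -> A *m B^T = B *m A^T ->
  GJval g = (block_mx A (- B) B A, (0, 0, k)) ->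
  let N := block_mx A (- B) B A in
  Ad g (Z, (P, Q, T)) =
  (N *m Z *m N^T, (lsubmx (row_mx P Q *m N^T), rsubmx (row_mx P Q *m N^T), T)).
Proof.
move=> h1 h2 hg N; rewrite -(KJ_conjJ _ _ _ _ h1 h2 hg) /Ad.
have lin : linear (conjJ g).
  move=> a [M1 [[l1 u1] c1]] [M2 [[l2 u2] c2]].
  rewrite -[_ *: _ + _]/(a *: M1 + M2, (a *: l1 + l2, a *: u1 + u2, a *: c1 + c2)).
  rewrite !(KJ_conjJ _ _ _ _ h1 h2 hg) -/N -add_row_mx -scale_row_mx.
  by rewrite !mulmxDr !mulmxDl -!scalemxAr -!scalemxAl !linearP.
pose L : {linear coordJ R n m -> coordJ R n m} :=
  HB.pack (conjJ g) (GRing.isLinear.Build _ _ _ _ _ lin).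
rewrite (@diff_lin _ _ _ L) // => x.
exact/differentiable_continuous/differentiable_conjJ.
Qed.

Lemma Ad_pJ g : KJ g -> set_fun pJ pJ (Ad g).
Proof.
move=> [A [B [k [h1 h2 hk hg]]]] _ [X [Y [P [Q [hX hY ->]]]]].
rewrite (Ad_KJ _ _ _ _ h1 h2 hg).
pose X' : 'M[R]_n := (A *m X - B *m Y) *m A^T - (A *m Y + B *m X) *m B^T.
pose Y' : 'M[R]_n := (A *m X - B *m Y) *m B^T + (A *m Y + B *m X) *m A^T.
set W := row_mx P Q *m _; exists X', Y', (lsubmx W), (rsubmx W); split.
- rewrite /X' !raddfB /= !trmx_mul !raddfB !raddfD /= !trmx_mul !trmxK hX hY.
  rewrite !(mulmxDl, mulmxDr, mulmxN, mulNmx) !mulmxA.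
  by apply/matrixP => i j; rewrite !mxE; ring.
- rewrite /Y' !raddfD /= !trmx_mul !raddfB !raddfD /= !trmx_mul !trmxK hX hY.
  rewrite !(mulmxDl, mulmxDr, mulmxN, mulNmx) !mulmxA.
  by apply/matrixP => i j; rewrite !mxE; ring.
- congr (_, _); rewrite tr_block_mx !mulmx_block [(- B)^T]raddfN /=.
  rewrite /X' /Y' !(mulmxDl, mulmxDr, mulmxN, mulNmx).
  by congr block_mx; apply/matrixP => i j; rewrite !mxE; ring.
Qed.

End CartanData.

(* Main.v *)
Require Import Defs.
From mathcomp Require Import all_boot all_order all_algebra.
From mathcomp Require Import complex spectral.
From mathcomp Require Import all_classical all_reals all_analysis.

(* [Ad k] acts by [Z |-> N Z N^T] and [(P, Q) |-> (P, Q) N^T], where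
   [N = [A, -B; B, A]] is the real form of [h = A + iB]; both sides are then
   the same expression in the blocks [A, B, X, Y, P, Q]. *)
Theorem theorem3p1 (R : realType) (n m : nat) (hn : (0 < n)%N) (hm : (0 < m)%N)
    (k : GJ R n m) (a : coordJ R n m) (hk : KJ k) (ha : pJ a) :
  Phi (Ad k a) = actUS (theta k) (Phi a).
Proof.
case: hk => A [B [kappa [h1 h2 _ hg]]]; case: ha => X [Y [P [Q [_ _ ->]]]].
(* The transpose does not conjugate, so each component on the right becomes one [cplxmx]. *)
rewrite (Ad_KJ _ _ _ _ h1 h2 hg) PhiE (thetaE hg) /actUS /= cplxmx_tr !cplxmx_mul.
(* [N^T = [A^T, B^T; -B^T, A^T]] acts on rows [(P, Q)] as right multiplication of [P + iQ] by
   [h^T]. *)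
rewrite tr_block_mx [((- B)^T)%R]GRing.raddfN /= mul_row_block row_mxKl row_mxKr.
(* With [U = AX - BY] and [V = AY + BX], the top blocks of [N Z N^T] are [U A^T - V B^T] and
   [U B^T + V A^T], up to the signs cleared last. *)
rewrite !mulmx_block block_mxKul block_mxKur.
by rewrite !(mulmxN, mulNmx, GRing.opprK).
Qed.
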